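(* For every $n\ge 1$, $s_n^k(123,132)=0$ for all $3\le k\le n$, and $$s_{2n}^2(123,132)=\frac{4^{n-1}+2}{3},\qquad s_{2n+1}^2(123,132)=0,$$ $$s_{2n}^1(123,132)=\frac{2(4^{n-1}-1)}{3},\qquad s_{2n+1}^1(123,132)=\frac{4^{n}+2}{3},$$ $$s_{2n}^0(123,132)=4^{n-1},\qquad s_{2n+1}^0(123,132)=\frac{2(4^{n}-1)}{3}.$$
   Context: $S_n$ denotes the set of permutations of $\{1,\dots,n\}$ written in one-line notation $\pi=\pi_1\pi_2\cdots\pi_n$. For $\alpha\in S_m$, $\pi\in S_n$ contains the pattern $\alpha$ if there are indices $i_1<i_2<\dots<i_m$ such that $\pi_{i_1}\pi_{i_2}\cdots\pi_{i_m}$ is order-isomorphic to $\alpha$; otherwise $\pi$ avoids $\alpha$. For a set $T$ of patterns, $S_n^k(T)$ is the set of $\pi\in S_n$ that have exactly $k$ fixed points (indices $i$ with $\pi_i=i$) and avoid every pattern in $T$; $s_n^k(T)=|S_n^k(T)|$. The braces around $T$ are omitted, e.g. $s_n^k(123,132)=s_n^k(\{123,132\})$. *)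

(* Defs.v *)
From mathcomp Require Import all_boot all_order all_fingroup all_algebra.

Set Implicit Arguments.
Unset Strict Implicit.
Unset Printing Implicit Defensive.

(* 'S_n is the type of permutations of 'I_n = {0, ..., n-1}; shifting indices
   and values by 1 changes neither fixed points nor pattern containment. *)
Definition one_line n (s : 'S_n) : seq nat :=
  [seq (nat_of_ord (s i)).+1 | i <- enum 'I_n].

Definition contains m n (alpha : 'S_m) (s : 'S_n) : bool :=
  [exists f : {ffun 'I_m -> 'I_n},
     [forall i : 'I_m, forall j : 'I_m, (i < j) ==> (f i < f j)]
     && [forall i : 'I_m, forall j : 'I_m,
          (alpha i < alpha j) == (s (f i) < s (f j))]].

Definition avoids m n (alpha : 'S_m) (s : 'S_n) : bool := ~~ contains alpha s.

(* A permutation of any length; patterns of different lengths may be mixed. *)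
Definition pattern := {m : nat & 'S_m}.

Definition fixed_points n (s : 'S_n) : {set 'I_n} := [set i | s i == i].

(* The finite set T of patterns is given by a list of its elements. *)
Definition avoiders (n k : nat) (T : seq pattern) : {set 'S_n} :=
  [set s : 'S_n | (#|fixed_points s| == k)
                  && all (fun p : pattern => avoids (tagged p) s) T].

Definition num_avoiders (n k : nat) (T : seq pattern) : nat :=
  #|avoiders n k T|.

Definition perm123 : 'S_3 := 1%g.
Definition perm132 : 'S_3 := tperm (inord 1) (inord 2).

Lemma one_line_perm123 : one_line perm123 = [:: 1; 2; 3].
Proof.
by rewrite /one_line !enum_ordSl enum_ord0 /= !perm1.
Qed.

Lemma one_line_perm132 : one_line perm132 = [:: 1; 3; 2].
Proof.
rewrite /one_line !enum_ordSl enum_ord0 /= /perm132.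
by rewrite !permE /= -!val_eqE /= !inordK.
Qed.

Definition p123 : pattern := Tagged (fun m => 'S_m) perm123.
Definition p132 : pattern := Tagged (fun m => 'S_m) perm132.

(* Main.v *)
Require Import Defs.
From mathcomp Require Import all_boot all_order all_fingroup all_algebra.
From mathcomp Require Import zify.

Import GRing.Theory.

Set Implicit Arguments.
Unset Strict Implicit.
Unset Printing Implicit Defensive.

(** A permutation avoids 123 and 132 exactly when each entry has at most one
    larger entry to its right: two larger entries to the right of x form, with
    x, one of the two patterns.  Reading left to right, every entry is therefore
    the largest or the second largest of those still unused.  Positions and
    values are counted from 0.  Before position p of a permutation of size n,
    the unused values are 0, ..., m - 1 together with one larger value c >= m,
    where m = n - 1 - p.  Placing c makes m - 1 the new large value, placing
    m - 1 keeps c, and in both cases m drops by one.  This gives the recursion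
    [words], and [num_avoidersE] identifies the numbers sought with the numbers
    [num_words] of words of this recursion that have a given number of fixed
    points.

    The value m - 1 is fixed only if p = m - 1, so at the position just before
    the middle of a permutation of even size.  The large value c is fixed only
    if it is placed at position c >= m.  So no fixed point can occur while
    p < m - 1; and once m <= p, a fixed point occurs just when the large value
    satisfies c >= p and is kept until position c.  There is then exactly one,
    since the later large values are all too small, and the number of ways to
    complete the word after position c is a power of 2 ([num_words_late]).
    This settles the words that start at the middle.  For even n the
    step p = m - 1 lies in between: it either places c and excludes all fixed
    points, or it makes a fixed point and the second one is optional
    ([num_words_middle]).

    Before the middle every count satisfies the same linear recursion
      N(p, c, m + 1) = N(p + 1, m, m) + N(p + 1, c, m),
    as no choice makes a fixed point.  The value at the middle is that power of
    2, both for one fixed point with n odd and for two fixed points with n even;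
    solving the recursion outwards from the middle, in r = (n - 1) / 2 steps
    rounded down, gives (4^r + 2) / 3 in both cases ([num_words_outward]).  For
    even n, half of all words have no fixed point, since this holds at the
    middle and both numbers double at each step.  The remaining numbers follow
    by subtraction from the total 2 ^ (n - 1). *)

(** * Avoidance as a condition on the word of a permutation *)

Fixpoint few_larger (w : seq nat) : bool :=
  if w is x :: t then (count (ltn x) t <= 1) && few_larger t else true.

Lemma count_gt1P (a : pred nat) (t : seq nat) :
  reflect (exists j k, [/\ j < k < size t, a (nth 0 t j) & a (nth 0 t k)])
          (1 < count a t).
Proof.
apply: (iffP idP).
  elim: t => //= x t IHt.
  case ax: (a x) => /= => [|/IHt [j [k [jk aj ak]]]]; last first.
    by exists j.+1, k.+1.
  rewrite add1n ltnS -has_count => /(has_nthP 0) [k ltk ak].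
  by exists 0, k.+1; split.
elim: t => [[j [k [/andP[]]]]//|x t IHt [[|j] [[|k] []]]] //=.
  move=> ltk -> ak; rewrite add1n ltnS -has_count.
  by apply/(has_nthP 0); exists k.
move=> jk aj ak; apply: leq_trans (leq_addl _ _).
by apply: IHt; exists j, k.
Qed.

Lemma few_largerPn (w : seq nat) :
  reflect (exists i j k, [/\ i < j, j < k < size w,
             nth 0 w i < nth 0 w j & nth 0 w i < nth 0 w k])
          (~~ few_larger w).
Proof.
apply: (iffP idP).
  elim: w => //= x t IHt; rewrite negb_and -ltnNge.
  case/orP => [/count_gt1P [j [k [jk xj xk]]]|/IHt [i [j [k [ij jk wij wik]]]]].
    by exists 0, j.+1, k.+1.
  by exists i.+1, j.+1, k.+1.
elim: w => [|x t IHt] [i [j [k [ij jk]]]] /=; first by case/andP: jk.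
case: j ij jk => // j ij; case: k => // k jk /= wij wik.
rewrite negb_and -ltnNge; case: i ij wij wik => [_|i ij] /= wij wik.
  by apply/orP; left; apply/count_gt1P; exists j, k.
by apply/orP; right; apply: IHt; exists i, j, k.
Qed.

(** One-line notation with values counted from 0, so that an entry at position
    i is a fixed point when it equals i. *)
Definition word n (s : 'S_n) : seq nat := [seq val (s i) | i <- enum 'I_n].

Lemma size_word n (s : 'S_n) : size (word s) = n.
Proof. by rewrite size_map size_enum_ord. Qed.

Lemma nth_word n (s : 'S_n) (i : 'I_n) : nth 0 (word s) i = s i.
Proof. by rewrite (nth_map i) ?size_enum_ord // nth_ord_enum. Qed.

Lemma word_inj n : injective (@word n).
Proof.
move=> s t st; apply/permP=> i; apply: val_inj.
by rewrite /= -!nth_word st.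
Qed.

Lemma perm_eq_word n (s : 'S_n) : perm_eq (word s) (iota 0 n).
Proof.
rewrite -val_enum_ord /word (map_comp val) perm_map //.
apply: uniq_perm; rewrite ?enum_uniq ?(map_inj_uniq perm_inj) ?enum_uniq //.
move=> i; rewrite mem_enum inE; apply/mapP; exists ((s^-1)%g i).
  by rewrite mem_enum.
by rewrite permKV.
Qed.

Lemma word_surj n (w : seq nat) :
  perm_eq w (iota 0 n) -> exists s : 'S_n, word s = w.
Proof.
move=> pw; have szw : size w = n by rewrite (perm_size pw) size_iota.
have uw : uniq w by rewrite (perm_uniq pw) iota_uniq.
have ltw (i : 'I_n) : nth 0 w i < n.
  have : nth 0 w i \in w by rewrite mem_nth // szw.
  by rewrite (perm_mem pw) mem_iota.
have inj : injective (fun i : 'I_n => Ordinal (ltw i)).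
  move=> i j [] /eqP; rewrite nth_uniq ?szw // => /eqP ij.
  exact: val_inj.
exists (perm inj); apply: (@eq_from_nth _ 0); rewrite size_word ?szw //.
move=> i lti; by rewrite (nth_word _ (Ordinal lti)) permE.
Qed.

Lemma perm132E (x : 'I_3) : val (perm132 x) = nth 0 [:: 0; 2; 1] x.
Proof.
by case: x => [[|[|[|//]]] ?]; rewrite /perm132 permE /= -!val_eqE /= !inordK.
Qed.

(** Occurrences of a pattern of length 3 as triples of positions, instead of
    finite functions on 'I_3. *)
Lemma containsE3 (alpha : 'S_3) n (s : 'S_n) :
  reflect (exists i j k : 'I_n, [/\ i < j, j < k &
     forall x y : 'I_3, (alpha x < alpha y) =
       (s (tnth [tuple i; j; k] x) < s (tnth [tuple i; j; k] y))])
    (contains alpha s).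
Proof.
apply: (iffP existsP) => [[f /andP[/forallP inc /forallP iso]]|].
  pose o h := @Ordinal 3 h.
  exists (f (o 0 isT)), (f (o 1 isT)), (f (o 2 isT)); split.
  - by have /forallP /(_ (o 1 isT)) := inc (o 0 isT).
  - by have /forallP /(_ (o 2 isT)) := inc (o 1 isT).
  have tE (x : 'I_3) :
      tnth [tuple f (o 0 isT); f (o 1 isT); f (o 2 isT)] x = f x.
    by case: x => [[|[|[|//]]] ?]; rewrite /tnth /=; congr (f _); apply: val_inj.
  by move=> x y; rewrite !tE; have /forallP /(_ y) /eqP := iso x.
case=> i [j [k [ij jk iso]]]; exists [ffun x => tnth [tuple i; j; k] x].
apply/andP; split; apply/forallP => x; apply/forallP => y; rewrite !ffunE.
  move: x y => [[|[|[|//]]] ?] [[|[|[|//]]] ?] //=; rewrite /tnth //=.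
  exact: ltn_trans jk.
by rewrite iso.
Qed.

(** Two entries y, z to the right of x and larger than x form with x the
    pattern 123 or 132, according to the order of y and z. *)
Lemma avoids_few_larger n (s : 'S_n) :
  avoids perm123 s && avoids perm132 s = few_larger (word s).
Proof.
rewrite /avoids -negb_or; apply: negb_inj; rewrite negbK.
apply/orP/few_largerPn.
  pose o h := @Ordinal 3 h.
  case=> /containsE3 [i [j [k [ij jk iso]]]]; exists i, j, k;
    rewrite size_word !nth_word jk ltn_ord; split=> //.
  - by have := iso (o 0 isT) (o 1 isT); rewrite !perm1 => <-.
  - by have := iso (o 0 isT) (o 2 isT); rewrite !perm1 => <-.
  - by have := iso (o 0 isT) (o 1 isT); rewrite !perm132E => <-.
  - by have := iso (o 0 isT) (o 2 isT); rewrite !perm132E => <-.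
case=> i [j [k [ij /andP[jk]]]]; rewrite size_word => ltk.
have ltj := ltn_trans jk ltk; have lti := ltn_trans ij ltj.
rewrite (nth_word s (Ordinal lti)) (nth_word s (Ordinal ltj)).
rewrite (nth_word s (Ordinal ltk)); move: ij jk.
set a := Ordinal lti; set b := Ordinal ltj; set c := Ordinal ltk.
rewrite -[i]/(val a) -[j]/(val b) -[k]/(val c) => ab bc sab sac.
have [sbc|scb|] := ltngtP (s b) (s c); last first.
- by move/val_inj/perm_inj=> eqbc; move: bc; rewrite eqbc ltnn.
- right; apply/containsE3; exists a, b, c; split=> // x y.
  rewrite !perm132E; move: x y => [[|[|[|//]]] ?] [[|[|[|//]]] ?];
  rewrite /tnth /=; lia.
- left; apply/containsE3; exists a, b, c; split=> // x y.
  rewrite !perm1; move: x y => [[|[|[|//]]] ?] [[|[|[|//]]] ?];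
  rewrite /tnth /=; lia.
Qed.

(** * Enumeration of the words *)

(** The arrangements of 0, ..., m - 1 and a larger value c in which each entry
    is the largest or the second largest of the unused values.  When c is
    placed first, m - 1 takes over its role. *)
Fixpoint words (c m : nat) : seq (seq nat) :=
  if m is m'.+1 then
    [seq c :: w | w <- words m' m'] ++ [seq m' :: w | w <- words c m']
  else [:: [:: c]].

Lemma size_words c m : size (words c m) = 2 ^ m.
Proof.
by elim: m c => //= m IHm c; rewrite size_cat !size_map !IHm expnS mul2n addnn.
Qed.

Lemma perm_iotaS m : perm_eq (iota 0 m.+1) (m :: iota 0 m).
Proof. by rewrite -addn1 iotaD /= cats1 perm_rcons. Qed.

Lemma count_ltn_iota x m : count (ltn x) (iota 0 m) = m - x.+1.
Proof.
elim: m => // m IHm; rewrite (seq.permP (perm_iotaS m)) /= IHm; lia.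
Qed.

Lemma mem_cons_map (T : eqType) (x y : T) (t : seq T) (l : seq (seq T)) :
  (x :: t \in [seq y :: w | w <- l]) = (x == y) && (t \in l).
Proof.
apply/mapP/andP => [[w wl [-> ->]]|[/eqP -> tl]]; first by rewrite eqxx.
by exists t.
Qed.

(** The first entry x has c - and, if x < m, all of x + 1, ..., m - 1 - to its
    right, so at most one larger entry means x = c or x = m - 1. *)
Lemma mem_words c m w : m <= c ->
  (w \in words c m) = perm_eq w (c :: iota 0 m) && few_larger w.
Proof.
elim: m c w => [|m IHm] c w lemc.
  rewrite inE; apply/eqP/andP => [->|[/perm_small_eq -> //]].
  by rewrite perm_refl.
have perm_c : perm_eq (c :: iota 0 m.+1) (c :: m :: iota 0 m).
  by rewrite perm_cons perm_iotaS.
have perm_m : perm_eq (c :: iota 0 m.+1) (m :: c :: iota 0 m).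
  by rewrite (perm_trans perm_c) // -(cat1s c) -(cat1s m) perm_catCA.
case: w => [|x t].
  by rewrite mem_cat; apply/orP/andP => [[] /mapP []|[/perm_size]].
rewrite mem_cat !mem_cons_map; apply/orP/andP.
  case=> /andP[/eqP ->]; rewrite IHm ?(ltnW lemc) // => /andP[pt gt].
    split=> /=; first by rewrite (permPr perm_c) perm_cons.
    rewrite gt andbT (seq.permP pt) /= count_ltn_iota; lia.
  split=> /=; first by rewrite (permPr perm_m) perm_cons.
  rewrite gt andbT (seq.permP pt) /= count_ltn_iota; lia.
case=> pw /= /andP[cnt gt].
have cntx : count (ltn x) t = (x < c) + ((x < m) + (m - x.+1)).
  move/seq.permP/(_ (ltn x)): (perm_trans pw perm_c).
  by rewrite /= count_ltn_iota ltnn.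
have : x \in c :: iota 0 m.+1 by rewrite -(perm_mem pw) mem_head.
rewrite inE mem_iota /= => /orP[/eqP eqx|ltx].
  left; rewrite eqx eqxx IHm // gt andbT /=.
  by move: pw; rewrite (permPr perm_c) eqx perm_cons.
have eqx : x = m by lia.
right; rewrite eqx eqxx IHm ?(ltnW lemc) // gt andbT /=.
by move: pw; rewrite (permPr perm_m) eqx perm_cons.
Qed.

Lemma uniq_words c m : m <= c -> uniq (words c m).
Proof.
elim: m c => // m IHm c lemc /=.
rewrite cat_uniq !map_inj_uniq ?IHm ?(ltnW lemc) //; try by move=> ? ? [].
rewrite andbT; apply/hasPn => _ /mapP [w _ ->].
by rewrite mem_cons_map negb_and; apply/orP; left; lia.
Qed.

(** * Fixed points of the words *)

(** Fixed points of a word whose first entry stands at position p. *)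
Fixpoint fixes (p : nat) (w : seq nat) : nat :=
  if w is x :: t then (x == p) + fixes p.+1 t else 0.

Lemma fixes_zip p w :
  fixes p w = count (fun u => u.1 == u.2) (zip w (iota p (size w))).
Proof. by elim: w p => //= x t IHt p; rewrite IHt. Qed.

Lemma card_fixed_points n (s : 'S_n) : #|fixed_points s| = fixes 0 (word s).
Proof.
rewrite fixes_zip size_word -val_enum_ord /word zip_map count_map.
by rewrite enumT cardsE cardE /enum_mem size_filter; apply: eq_count.
Qed.

(** The argument a selects the numbers of fixed points that are counted, so that
    one recursion serves exact numbers and conditions such as more than two. *)
Definition num_words (a : pred nat) (p c m : nat) : nat :=
  count (fun w => a (fixes p w)) (words c m).

Lemma num_wordsS a p c m :
  num_words a p c m.+1 =
    num_words (fun k => a ((c == p) + k)) p.+1 m m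
  + num_words (fun k => a ((m == p) + k)) p.+1 c m.
Proof. by rewrite /num_words /= count_cat !count_map. Qed.

(** Before the middle both possible entries, c and m, are too large to be fixed,
    so the fixed points are decided by the rest of the word alone. *)
Lemma num_words_early a p c m : p < m -> p < c ->
  num_words a p c m.+1 = num_words a p.+1 m m + num_words a p.+1 c m.
Proof. by move=> pm pc; rewrite num_wordsS !gtn_eqF. Qed.

(** All values are smaller than all positions. *)
Lemma fixes0 p c m w : m <= p -> c < p -> m <= c -> w \in words c m ->
  fixes p w = 0.
Proof.
elim: m p c w => [|m IHm] p c w lemp ltcp lemc /=.
  by rewrite inE => /eqP -> /=; rewrite ltn_eqF.
rewrite mem_cat => /orP[] /mapP [t tw ->] /=.
  by rewrite ltn_eqF // (IHm _ m) //; lia.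
by rewrite ltn_eqF // (IHm _ c) //; lia.
Qed.

Lemma num_words_none a p c m : m <= p -> c < p -> m <= c ->
  num_words a p c m = a 0 * 2 ^ m.
Proof.
move=> mp cp mc; rewrite /num_words -(size_words c).
under eq_in_count => w /(fixes0 mp cp mc) -> do [].
by case: (a 0); rewrite ?count_predT ?count_pred0 ?mul1n.
Qed.

(** Only c can become a fixed point, and it does if the entries before position
    c are the second largest ones.  These are forced, and after placing c there
    remain p + m - c values that can be arranged in 2 ^ (p + m - c).-1 ways.
    The truncated predecessor is meant: for c = p + m nothing remains to be
    placed, which can be done in one way. *)
Lemma num_words_late p c m : m <= p -> p <= c <= p + m ->
  num_words (pred1 1) p c m = 2 ^ (p + m - c).-1.
Proof.
elim: m p c => [|m IHm] p c mp pc.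
  have -> : c = p by lia.
  by rewrite /num_words /= eqxx !addn0 subnn.
rewrite num_wordsS (@num_words_none _ _ _ m); try lia.
have -> : (m == p) = false by lia.
have [eqc|nec] := eqVneq c p.
  rewrite (@num_words_none _ _ c m) //; try lia.
  by rewrite mul1n mul0n addn0 eqc addKn.
by rewrite mul0n IHm ?addnS ?addSn //; lia.
Qed.

(** After the middle, placing the large value c as a fixed point leaves only
    values below the positions, so a second fixed point is impossible. *)
Lemma num_words_late_gt1 a p c m : a 0 = false -> a 1 = false ->
  m <= p -> p <= c <= p + m -> num_words a p c m = 0.
Proof.
move=> a0 a1; elim: m p c => [|m IHm] p c mp pc.
  have -> : c = p by lia.
  by rewrite /num_words /= eqxx addn0 a1.
rewrite num_wordsS (@num_words_none _ _ _ m); try lia.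
have -> : (m == p) = false by lia.
have [eqc|nec] := eqVneq c p.
  by rewrite (@num_words_none _ _ c m) ?a0 ?a1 //; lia.
by rewrite a0 mul0n IHm //; lia.
Qed.

(** At the position just before the middle of a word of even length, placing c
    leaves only values below the positions, and placing p creates a fixed
    point. *)
Lemma num_words_middle a p c : p < c <= p.*2.+1 ->
  num_words a p c p.+1 = a 0 * 2 ^ p + num_words (a \o S) p.+1 c p.
Proof.
move=> pc; rewrite num_wordsS eqxx.
have -> : (c == p) = false by lia.
by rewrite (@num_words_none _ _ p p) //; lia.
Qed.

(** * From the middle to the whole word *)

(** The middle of the word is the state m = p + d, with d = 0 or d = 1 according
    to the parity of the length, and the state here is r steps before it.  For
    fixed c the count is a term depending on c, which the recursion carries
    along unchanged, plus a term S(p, r) independent of c.  In the step from r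
    to r + 1, the state with the new large value contributes the power 2 ^ p as
    its first term, so that S(p, r + 1) = 2 S(p + 1, r) + 2 ^ p; the solution
    with S(p, 0) = 0 is (2 ^ (p + 2 r) - 2 ^ p) / 3. *)
Lemma num_words_outward a d r p c :
    (forall p c, p + d <= c <= p.*2 + d ->
       num_words a p c (p + d) = 2 ^ (p.*2 + d - c).-1) ->
    p + d + r.*2 <= c <= (p + r).*2 + d ->
  3 * num_words a p c (p + d + r.*2) + 2 ^ p
    = 3 * 2 ^ ((p + r).*2 + d - c).-1 + 2 ^ (p + r.*2).
Proof.
move=> base; elim: r p c => [|r IHr] p c pc.
  by rewrite !addn0 base //; lia.
have -> : p + d + r.+1.*2 = (p.+1 + d + r.*2).+1 by lia.
rewrite num_words_early; try lia.
have := IHr p.+1 (p.+1 + d + r.*2).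
have := IHr p.+1 c.
have -> : (p.+1 + r).*2 + d - (p.+1 + d + r.*2) = p.+1 by lia.
have -> : (p + r.+1).*2 = (p.+1 + r).*2 by lia.
have -> : p + r.+1.*2 = (p.+1 + r.*2).+1 by lia.
rewrite /= !expnS; lia.
Qed.

(** The recursion before the middle creates no fixed points, so a number of
    fixed points that cannot occur after the middle cannot occur at all. *)
Lemma num_words_outward0 a d r p c :
    (forall p c, p + d <= c <= p.*2 + d -> num_words a p c (p + d) = 0) ->
    p + d + r.*2 <= c <= (p + r).*2 + d ->
  num_words a p c (p + d + r.*2) = 0.
Proof.
move=> base; elim: r p c => [|r IHr] p c pc.
  by rewrite addn0 base //; lia.
have -> : p + d + r.+1.*2 = (p.+1 + d + r.*2).+1 by lia.
by rewrite num_words_early ?IHr //; lia.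
Qed.

(** At the middle, the words without fixed points are the 2 ^ p words that place
    c there; one step outwards doubles their number. *)
Lemma num_words_even0 r p c : p.+1 + r.*2 <= c <= (p + r).*2.+1 ->
  num_words (pred1 0) p c (p.+1 + r.*2) = 2 ^ (p + r.*2).
Proof.
elim: r p c => [|r IHr] p c pc.
  rewrite !addn0 num_words_middle; last by lia.
  by rewrite /= mul1n /num_words (eq_count (a2 := pred0)) ?count_pred0 ?addn0.
have -> : p.+1 + r.+1.*2 = (p.+2 + r.*2).+1 by lia.
rewrite num_words_early ?IHr; try lia.
by rewrite addnn -mul2n -expnS; congr (2 ^ _); lia.
Qed.

(** * Counting the permutations *)

Lemma num_avoidersE m k :
  num_avoiders m.+1 k [:: p123; p132] = num_words (pred1 k) 0 m m.
Proof.
rewrite /num_avoiders cardE -(size_map (@word m.+1)) /num_words -size_filter.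
apply/perm_size/uniq_perm.
- by rewrite (map_inj_uniq (@word_inj _)) enum_uniq.
- by rewrite filter_uniq ?uniq_words.
have mem_avoid (s : 'S_m.+1) : (s \in avoiders m.+1 k [:: p123; p132]) =
    (fixes 0 (word s) == k) && few_larger (word s).
  by rewrite inE card_fixed_points /= andbT avoids_few_larger.
move=> w; rewrite mem_filter mem_words //= -(permPr (perm_iotaS m)).
apply/mapP/idP => [[s]|].
  rewrite mem_enum mem_avoid => /andP[fs gs] ->.
  by apply/and3P; rewrite perm_eq_word.
case/and3P => fs /word_surj [s eqw] gs; exists s => //.
by rewrite mem_enum mem_avoid eqw fs gs.
Qed.

Lemma num_words_total p c m :
  2 ^ m = num_words (pred1 0) p c m + num_words (pred1 1) p c m
        + num_words (pred1 2) p c m + num_words (ltn 2) p c m.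
Proof.
rewrite -(size_words c) /num_words; elim: (words c m) => //= w l ->.
case: (fixes p w) => [|[|[|k]]] /=; lia.
Qed.

Lemma expn2_double r : 2 ^ r.*2 = 4 ^ r.
Proof. by rewrite -mul2n expnM. Qed.

Lemma num_words_odd1 r :
  3 * num_words (pred1 1) 0 r.*2 r.*2 = 4 ^ r + 2.
Proof.
have := @num_words_outward (pred1 1) 0 r 0 r.*2.
rewrite !add0n !addn0 subnn /= !expn0 expn2_double leqnn => /(_ _ isT) count1.
suff /count1 : forall p c, p + 0 <= c <= p.*2 + 0 ->
    num_words (pred1 1) p c (p + 0) = 2 ^ (p.*2 + 0 - c).-1 by lia.
by move=> p c; rewrite !addn0 => pc; rewrite num_words_late ?addnn //; lia.
Qed.

Lemma num_words_odd_gt1 a r : a 0 = false -> a 1 = false ->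
  num_words a 0 r.*2 r.*2 = 0.
Proof.
move=> a0 a1; have := @num_words_outward0 a 0 r 0 r.*2; rewrite !addn0 !add0n.
apply; last by rewrite leqnn.
by move=> p c; rewrite !addn0 => pc; apply: num_words_late_gt1 => //; lia.
Qed.

Lemma num_words_even2 r :
  3 * num_words (pred1 2) 0 r.*2.+1 r.*2.+1 = 4 ^ r + 2.
Proof.
have := @num_words_outward (pred1 2) 1 r 0 r.*2.+1.
rewrite !add0n !add1n !addn1 subnn /= !expn0 expn2_double leqnn.
move=> /(_ _ isT) count2.
suff /count2 : forall p c, p + 1 <= c <= p.*2 + 1 ->
    num_words (pred1 2) p c (p + 1) = 2 ^ (p.*2 + 1 - c).-1 by lia.
move=> p c; rewrite !addn1 => pc; rewrite num_words_middle //.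
by rewrite num_words_late ?addSn ?addnn //; lia.
Qed.

Lemma num_words_even_gt2 a r : a 0 = false -> a 1 = false -> a 2 = false ->
  num_words a 0 r.*2.+1 r.*2.+1 = 0.
Proof.
move=> a0 a1 a2; have := @num_words_outward0 a 1 r 0 r.*2.+1.
rewrite !add0n !add1n !addn1; apply; last by rewrite leqnn.
move=> p c; rewrite !addn1 => pc.
rewrite num_words_middle ?a0; last by lia.
by rewrite num_words_late_gt1 //; lia.
Qed.

Theorem theorem2p2 (n : nat) (hn : (1 <= n)%N) :
  let s m k : nat := num_avoiders m k [:: p123; p132] in
  (forall k : nat, (3 <= k <= n)%N -> s n k = 0%N) /\
  ((s (2 * n)%N 2%N)%:R = (4 ^+ (n - 1) + 2) / 3 :> rat)%R /\
  s (2 * n + 1)%N 2%N = 0%N /\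
  ((s (2 * n)%N 1%N)%:R = 2 * (4 ^+ (n - 1) - 1) / 3 :> rat)%R /\
  ((s (2 * n + 1)%N 1%N)%:R = (4 ^+ n + 2) / 3 :> rat)%R /\
  s (2 * n)%N 0%N = (4 ^ (n - 1))%N /\
  ((s (2 * n + 1)%N 0%N)%:R = 2 * (4 ^+ n - 1) / 3 :> rat)%R.
Proof.
case: n hn => // n _ s.
have seven k : s (2 * n.+1) k = num_words (pred1 k) 0 n.*2.+1 n.*2.+1.
  by rewrite -num_avoidersE /s mul2n.
have sodd k : s (2 * n.+1 + 1) k = num_words (pred1 k) 0 n.+1.*2 n.+1.*2.
  by rewrite -num_avoidersE /s mul2n addn1.
have ge3 k : 3 <= k -> s n.+1 k = 0.
  move=> k3; rewrite /s num_avoidersE -(odd_double_half n).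
  case: (odd n); rewrite ?add0n ?add1n.
    by apply: num_words_even_gt2; rewrite /=; lia.
  by apply: num_words_odd_gt1; rewrite /=; lia.
have even2 : 3 * s (2 * n.+1) 2 = 4 ^ n + 2 by rewrite seven num_words_even2.
have even0 : s (2 * n.+1) 0 = 4 ^ n.
  have := @num_words_even0 n 0 n.*2.+1; rewrite seven !add0n !add1n leqnn.
  by move=> ->; rewrite ?expn2_double.
have even_total : 2 * 4 ^ n = s (2 * n.+1) 0 + s (2 * n.+1) 1 + s (2 * n.+1) 2.
  rewrite !seven -expn2_double -expnS (num_words_total 0 n.*2.+1).
  by rewrite (@num_words_even_gt2 (ltn 2)) // addn0.
have odd2 : s (2 * n.+1 + 1) 2 = 0 by rewrite sodd num_words_odd_gt1.
have odd1 : 3 * s (2 * n.+1 + 1) 1 = 4 ^ n.+1 + 2.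
  by rewrite sodd num_words_odd1.
have odd_total : 4 ^ n.+1 = s (2 * n.+1 + 1) 0 + s (2 * n.+1 + 1) 1.
  rewrite !sodd -expn2_double (num_words_total 0 n.+1.*2).
  rewrite (@num_words_odd_gt1 (pred1 2)) // (@num_words_odd_gt1 (ltn 2)) //.
  by rewrite !addn0.
(* The identities above are in nat; this turns them into the quotients by 3. *)
have toQ (a b : nat) : 3 * a = b -> (a%:R = b%:R / 3%:R :> rat)%R.
  by move=> <-; rewrite natrM mulrC mulKf.
rewrite subn1 /= -!natrX; split; first by move=> k /andP[/ge3].
split; first by rewrite (toQ _ _ even2) natrD.
split=> //.
split.
  rewrite (toQ _ (2 * (4 ^ n - 1))); last by lia.
  by rewrite natrM natrB // expn_gt0.
split; first by rewrite (toQ _ _ odd1) natrD.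
split=> //.
rewrite (toQ _ (2 * (4 ^ n.+1 - 1))); last by lia.
by rewrite natrM natrB // expn_gt0.
Qed.
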